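(* Let $\Bbbk:\mathbb{T}\times\mathbb{T}\to\mathbb{R}$ be a stable Mercer kernel with $\mu_0,\mu_1<\infty$ and RKHS $\mathscr{H}_{\Bbbk}$; if $\mathbb{T}=\mathbb{R}_+$, assume in addition that $\lim_{\omega\to\infty}\int_{\mathbb{R}_+}\int_{\mathbb{R}_+}\Bbbk(s,t)e^{-\mathrm{j}\omega(s-t)}\,ds\,dt=0$. Let $\mathrm{u}$ be a bounded input signal, $\mathscr{T}\subset\mathbb{T}$ a finite set of measurement times with data $(y_t)_{t\in\mathscr{T}}$ in $\mathbb{R}$, $\lambda>0$, $\epsilon\in(0,1)$, and let $\mathscr{P}$ be a partition of $[0,\omega_{\max}]$. Then the problem $$\min_{\mathrm{g}\in\mathscr{H}_{\Bbbk}}\ \sum_{t\in\mathscr{T}}\big(\mathrm{L}^{\mathrm{u}}_t(\mathrm{g})-y_t\big)^2+\lambda\|\mathrm{g}\|_{\mathscr{H}_{\Bbbk}}^2\quad\text{s.t.}\quad|\mathcal{F}_\omega(\mathrm{g})|^2\le1-\epsilon\ \ \text{for all }\omega\in\mathscr{P}$$ is a convex program with a unique solution $\mathrm{g}^{(\star,\epsilon)}$, and $$\|\mathrm{g}^{(\star,\epsilon)}\|_{\mathscr{H}_{\Bbbk}}\le\Big(\frac1\lambda\sum_{t\in\mathscr{T}}y_t^2\Big)^{1/2}.$$ Moreover, if $\operatorname{mesh}(\mathscr{P})\le\frac{2\epsilon}{L}$, where $L:=\frac1\lambda\,4\mu_0\mu_1\sum_{t\in\mathscr{T}}y_t^2$,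 then $$\sup_{\omega\in\Omega_{\mathbb{T}}}|\mathcal{F}_\omega(\mathrm{g}^{(\star,\epsilon)})|\le1,$$ i.e. the $\mathcal{H}_\infty$-norm of the transfer function of $\mathrm{g}^{(\star,\epsilon)}$ is at most $1$.
   Context: $\mathbb{T}$ denotes either $\mathbb{Z}_+=\{0,1,2,\dots\}$ or $\mathbb{R}_+=[0,\infty)$. $\Omega_{\mathbb{T}}=[0,\pi]$ if $\mathbb{T}=\mathbb{Z}_+$ and $\Omega_{\mathbb{T}}=\mathbb{R}_+$ if $\mathbb{T}=\mathbb{R}_+$. A Mercer kernel is a continuous symmetric positive semidefinite function $\Bbbk:\mathbb{T}\times\mathbb{T}\to\mathbb{R}$; $\mathscr{H}_{\Bbbk}\subseteq\mathbb{R}^{\mathbb{T}}$ is its (real) RKHS. $\Bbbk$ is stable if $\mathscr{H}_{\Bbbk}\subseteq\ell^1(\mathbb{Z}_+)$ (resp. $L^1(\mathbb{R}_+)$). For $n\in\mathbb{Z}_+$, $\mu_n=\sum_{t\in\mathbb{Z}_+}t^n\Bbbk(t,t)^{1/2}$ if $\mathbb{T}=\mathbb{Z}_+$ and $\mu_n=\int_{\mathbb{R}_+}t^n\Bbbk(t,t)^{1/2}\,dt$ if $\mathbb{T}=\mathbb{R}_+$. The input $\mathrm{u}$ is in $\ell^\infty(\mathbb{Z})$ (resp. $L^\infty(\mathbb{R})$), and $\mathrm{L}^{\mathrm{u}}_t(\mathrm{g})=\sum_{s\in\mathbb{Z}_+}g_su_{t-s}$ (resp. $\int_{\mathbb{R}_+}g_su_{t-s}\,ds$).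 $\mathcal{F}_\omega(\mathrm{g})=\sum_{t\in\mathbb{Z}_+}g_te^{-\mathrm{j}\omega t}$ (resp. $\int_{\mathbb{R}_+}g_te^{-\mathrm{j}\omega t}\,dt$), $\mathrm{j}$ the imaginary unit. A partition of $[a,b]$ is a finite set $\mathscr{P}=\{\omega_0,\dots,\omega_{n}\}$ with $a=\omega_0<\omega_1<\dots<\omega_n=b$, and $\operatorname{mesh}(\mathscr{P})=\max_{1\le i\le n}|\omega_i-\omega_{i-1}|$. The number $\omega_{\max}$: if $\mathbb{T}=\mathbb{Z}_+$, $\omega_{\max}=\pi$; if $\mathbb{T}=\mathbb{R}_+$, $\omega_{\max}>0$ is a fixed real number such that $\big|\int_{\mathbb{R}_+}\int_{\mathbb{R}_+}\Bbbk(s,t)e^{-\mathrm{j}\omega(s-t)}\,ds\,dt\big|\le\lambda/\sum_{t\in\mathscr{T}}y_t^2$ for all $\omega>\omega_{\max}$ (it exists by the limit assumption). Conventions: quotients with positive numerator and zero denominator are $+\infty$. *)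

(* Defs.v *)
From HB Require Import structures.
From mathcomp Require Import all_boot all_order all_algebra finmap.
From mathcomp Require Import complex.
From mathcomp Require Import all_classical all_reals all_analysis.

Set Implicit Arguments.
Unset Strict Implicit.
Unset Printing Implicit Defensive.

Import Order.TTheory GRing.Theory Num.Theory.
Import numFieldTopology.Exports numFieldNormedType.Exports.

Local Open Scope classical_set_scope.
Local Open Scope ring_scope.

Notation cmod := ComplexField.Normc.normc.

Variant time_kind := discrete_time | continuous_time.

Definition time (R : realType) (tk : time_kind) : topologicalType :=
  match tk with
  | discrete_time => nat
  | continuous_time => (`[0 : R, +oo[%classic : Type)
  end.

Definition time_val (R : realType) (tk : time_kind) : time R tk -> R :=
  match tk with
  | discrete_time => fun t : nat => t%:R
  | continuous_time => fun t : (`[0 : R, +oo[%classic : Type) => val t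
  end.

(* The functions on [0, +oo[ are extended by 0 (operator [valL_]) so as to be
   integrated over the subset [0, +oo[ of the real line. *)
Definition time_integral (R : realType) (tk : time_kind) :
    (time R tk -> \bar R) -> \bar R :=
  match tk with
  | discrete_time => fun f : nat -> \bar R => (\sum_(0 <= t <oo) f t)%E
  | continuous_time => fun f : (`[0 : R, +oo[%classic : Type) -> \bar R =>
      (\int[@lebesgue_measure R]_(t in `[0%R, +oo[) valL_ 0 f t)%E
  end.

(* Equal to the usual integral (or sum) for absolutely integrable functions,
   which is the only case of interest. *)
Definition time_Rintegral (R : realType) (tk : time_kind)
    (f : time R tk -> R) : R :=
  fine (time_integral (fun t => (f t)%:E)).

Definition time_Cintegral (R : realType) (tk : time_kind)
    (f : time R tk -> R[i]) : R[i] :=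
  Complex (time_Rintegral (fun t => complex.Re (f t)))
          (time_Rintegral (fun t => complex.Im (f t))).

Definition integrable_signal (R : realType) (tk : time_kind) :
    set (time R tk -> R) :=
  match tk with
  | discrete_time => [set g : nat -> R | (\sum_(0 <= t <oo) `|g t|%:E < +oo)%E]
  | continuous_time => [set g : (`[0 : R, +oo[%classic : Type) -> R |
      (@lebesgue_measure R).-integrable `[0, +oo[ (EFin \o valL_ 0 g)]
  end.

Definition positive_semidefinite (R : realType) (T : Type) (k : T -> T -> R) :=
  forall (n : nat) (x : 'I_n -> T) (c : 'I_n -> R),
    0 <= \sum_(i < n) \sum_(j < n) c i * c j * k (x i) (x j).

Record mercer_kernel (R : realType) (T : topologicalType) (k : T -> T -> R) :
    Prop := {
  mercer_continuous : continuous (fun st : T * T => k st.1 st.2) ;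
  mercer_sym : forall s t, k s t = k t s ;
  mercer_psd : positive_semidefinite k }.

(* A Hilbert space of functions on T which contains the sections of k and in
   which they represent the evaluations. It exists as soon as k is symmetric
   and positive semidefinite and is then unique (Moore-Aronszajn), up to the
   values of [rkhs_ip] outside [rkhs_space]. *)
Record rkhs (R : realType) (T : Type) (k : T -> T -> R) := {
  rkhs_space : set (T -> R) ;
  rkhs_ip : (T -> R) -> (T -> R) -> R ;
  rkhs0 : rkhs_space 0 ;
  rkhsD : forall f g, rkhs_space f -> rkhs_space g -> rkhs_space (f + g) ;
  rkhsZ : forall (a : R) f, rkhs_space f -> rkhs_space (a *: f) ;
  rkhs_ipC : forall f g, rkhs_space f -> rkhs_space g ->
    rkhs_ip f g = rkhs_ip g f ;
  rkhs_ip_linear : forall (a : R) f g h,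
    rkhs_space f -> rkhs_space g -> rkhs_space h ->
    rkhs_ip (a *: f + g) h = a * rkhs_ip f h + rkhs_ip g h ;
  rkhs_ip_gt0 : forall f, rkhs_space f -> f <> 0 -> 0 < rkhs_ip f f ;
  rkhs_complete : forall f : nat -> T -> R,
    (forall n, rkhs_space (f n)) ->
    (forall e : R, 0 < e -> exists N : nat, forall m n : nat,
      (N <= m)%N -> (N <= n)%N ->
      Num.sqrt (rkhs_ip (f m - f n) (f m - f n)) < e) ->
    exists2 g, rkhs_space g &
      Num.sqrt (rkhs_ip (f n - g) (f n - g)) @[n --> \oo] --> (0 : R) ;
  rkhs_section : forall t, rkhs_space (k t) ;
  rkhs_reproducing : forall f t, rkhs_space f -> rkhs_ip f (k t) = f t }.

Definition rkhs_norm (R : realType) (T : Type) (k : T -> T -> R) (H : rkhs k)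
    (g : T -> R) : R :=
  Num.sqrt (rkhs_ip H g g).

Definition stable_kernel (R : realType) (tk : time_kind)
    (k : time R tk -> time R tk -> R) (H : rkhs k) : Prop :=
  rkhs_space H `<=` @integrable_signal R tk.

Definition kernel_moment (R : realType) (tk : time_kind)
    (k : time R tk -> time R tk -> R) (n : nat) : \bar R :=
  time_integral (fun t => (time_val t ^+ n * Num.sqrt (k t t))%:E).

Definition input_time (R : realType) (tk : time_kind) : Type :=
  match tk with discrete_time => int | continuous_time => R end.

Definition time_sub (R : realType) (tk : time_kind) :
    time R tk -> time R tk -> input_time R tk :=
  match tk with
  | discrete_time => fun t s : nat => t%:Z - s%:Z
  | continuous_time => fun t s : (`[0 : R, +oo[%classic : Type) => val t - val s
  end.

(* In continuous time, [u] is a Borel representative of its class in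
   $L^\infty(\mathbb{R})$. *)
Definition bounded_input (R : realType) (tk : time_kind) :
    set (input_time R tk -> R) :=
  match tk with
  | discrete_time => [set u : int -> R | exists M : R, forall n, `|u n| <= M]
  | continuous_time => [set u : R -> R | u \in Lfun (@lebesgue_measure R) +oo%E]
  end.

Definition system_output (R : realType) (tk : time_kind)
    (u : input_time R tk -> R) (t : time R tk) (g : time R tk -> R) : R :=
  time_Rintegral (fun s => g s * u (time_sub t s)).

(* $e^{\mathrm{j}\theta}$ *)
Definition expj (R : realType) (theta : R) : R[i] :=
  Complex (cos theta) (sin theta).

Definition fourier (R : realType) (tk : time_kind) (w : R)
    (g : time R tk -> R) : R[i] :=
  time_Cintegral (fun t => (g t)%:C%C * expj (- (w * time_val t))).

Definition kernel_fourier (R : realType) (tk : time_kind)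
    (k : time R tk -> time R tk -> R) (w : R) : R[i] :=
  time_Cintegral (fun t => time_Cintegral (fun s =>
    (k s t)%:C%C * expj (- (w * (time_val s - time_val t))))).

Definition frequencies (R : realType) (tk : time_kind) : set R :=
  match tk with
  | discrete_time => `[0, pi]
  | continuous_time => `[0, +oo[
  end.

Definition data_energy (R : realType) (tk : time_kind)
    (A : {fset time R tk}) (y : time R tk -> R) : R :=
  \sum_(t <- A) y t ^+ 2.

(* [lambda / 0] is [+oo] in [\bar R] for positive [lambda]. *)
Definition is_omega_max (R : realType) (tk : time_kind)
    (k : time R tk -> time R tk -> R) (A : {fset time R tk})
    (y : time R tk -> R) (lambda omega_max : R) : Prop :=
  match tk with
  | discrete_time => omega_max = pi
  | continuous_time => 0 < omega_max /\ forall w : R, omega_max < w ->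
      ((cmod (kernel_fourier k w))%:E <= lambda%:E / (data_energy A y)%:E)%E
  end.

(* [s] lists the points of a partition in increasing order, both endpoints
   included. *)
Definition mesh (R : realType) (s : seq R) : R :=
  \big[Num.max/0]_(i < (size s).-1) `|s`_i.+1 - s`_i|.

Definition lipschitz_bound (R : realType) (tk : time_kind)
    (k : time R tk -> time R tk -> R) (A : {fset time R tk})
    (y : time R tk -> R) (lambda : R) : \bar R :=
  ((lambda^-1)%:E * 4%:E * kernel_moment k 0 * kernel_moment k 1
   * (data_energy A y)%:E)%E.

(* minimize [objective] over the elements [g] of [domain] such that
   [c g <= 0] for every [c] in [constraints] *)
Record problem (R : realType) (V : lmodType R) := Problem {
  domain : set V ;
  objective : V -> R ;
  constraints : set (V -> R) }.

Definition feasible (R : realType) (V : lmodType R) (P : problem V) : set V :=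
  [set g | domain P g /\ forall c, constraints P c -> c g <= 0].

Definition is_solution (R : realType) (V : lmodType R) (P : problem V) (g : V) :=
  feasible P g /\ forall h, feasible P h -> objective P g <= objective P h.

Definition convex_program (R : realType) (V : lmodType R) (P : problem V) :=
  [/\ convex_set (domain P), convex_function (domain P) (objective P) &
      forall c, constraints P c -> convex_function (domain P) c].

Definition identification_problem (R : realType) (tk : time_kind)
    (k : time R tk -> time R tk -> R) (H : rkhs k)
    (u : input_time R tk -> R) (A : {fset time R tk}) (y : time R tk -> R)
    (lambda eps : R) (ws : seq R) : problem (time R tk -> R) :=
  Problem (rkhs_space H)
    (fun g => \sum_(t <- A) (system_output u t g - y t) ^+ 2
              + lambda * rkhs_norm H g ^+ 2)
    [set (fun g => cmod (fourier w g) ^+ 2 - (1 - eps)) | w in [set` ws]].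

(* Main.v *)
Require Import Defs.
From HB Require Import structures.
From mathcomp Require Import all_boot all_order all_algebra finmap.
From mathcomp Require Import complex.
From mathcomp Require Import all_classical all_reals all_analysis.
From mathcomp Require Import measurable_realfun ess_sup_inf.
From mathcomp Require Import ring lra.

Set Implicit Arguments.
Unset Strict Implicit.
Unset Printing Implicit Defensive.

Import Order.TTheory GRing.Theory Num.Theory.
Import numFieldTopology.Exports numFieldNormedType.Exports.

Local Open Scope classical_set_scope.
Local Open Scope ring_scope.

(** Let E be the sum of the squares of the data, |g| the norm of the RKHS H and
    mu_0, mu_1 the moments of the kernel.

    By the reproducing property and the Cauchy-Schwarz inequality,
    |g(t)| <= |g| k(t,t)^(1/2) for g in H. Hence the integral of g against a
    signal bounded by M is at most M mu_0 |g| ([multiplier_functional]), so that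
    the outputs of the system and the real and imaginary parts of the Fourier
    transform at a given frequency are bounded linear functionals on H. The
    problem is thus to minimize a continuous and strongly convex function over a
    closed convex subset of a Hilbert space, a subset that contains 0: there is
    exactly one minimizer ([unique_minimizer]), and the comparison with 0 yields
    lambda |g|^2 <= E for the solution g.

    Let F_w(g) be the Fourier transform of g at w. As cos and sin are
    1-Lipschitz, |F_w(g)|^2 is a Lipschitz function of w, with a constant
    4 mu_0 mu_1 |g|^2 which is at most L for the solution g
    ([dist_sqr_cmod_fourier_le]). A frequency of [0, omega_max] is at distance
    at most mesh / 2 <= eps / L from a point of the partition
    ([near_partition_point]), where |F_w(g)|^2 <= 1 - eps. Whence
    |F_w(g)|^2 <= 1 on [0, omega_max].

    Beyond omega_max, the bound comes from
    |F_w(g)|^2 <= |g|^2 |K(w)|, where K(w) is the double integral of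
    k(s,t) e^(-j w (s - t)) ([sqr_cmod_fourier_le_kernel_fourier]): K(w) is the
    sum of the squares of the norms of the Riesz representers of the real and
    imaginary parts of F_w. By the choice of omega_max, the right-hand side is
    at most (E / lambda) (lambda / E) = 1, unless E = 0, in which case g = 0.

    Discrete and continuous time are treated together: both are described by a
    measure space ([time_model]). *)

(** * Hilbert space geometry of an RKHS *)

Lemma cvg_of_dist_le (R : realType) (a b : nat -> R) (c : R) :
  (forall n, `|a n - c| <= b n) -> b n @[n --> \oo] --> (0 : R) ->
  a n @[n --> \oo] --> c.
Proof.
move=> ab b0.
apply: (@squeeze_cvgr _ _ _ _ (fun n => c - b n) (fun n => c + b n)).
- by apply: nearW => n; rewrite -ler_distl.
- by rewrite -[X in _ --> X]subr0; apply: cvgB => //; exact: cvg_cst.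
- by rewrite -[X in _ --> X]addr0; apply: cvgD => //; exact: cvg_cst.
Qed.

Section Hilbert.
Context (R : realType) (T : Type) (k : T -> T -> R) (H : rkhs k).
Implicit Types (f g h : T -> R) (a b : R).
Local Notation V := (rkhs_space H).
Local Notation ip := (rkhs_ip H).
Local Notation nrm := (rkhs_norm H).

Lemma rkhsN f : V f -> V (- f).
Proof. by move=> Vf; rewrite -scaleN1r; exact: rkhsZ. Qed.

Lemma rkhsB f g : V f -> V g -> V (f - g).
Proof. by move=> Vf Vg; apply: rkhsD => //; exact: rkhsN. Qed.

Lemma rkhs_ipDl f g h : V f -> V g -> V h -> ip (f + g) h = ip f h + ip g h.
Proof.
by move=> Vf Vg Vh; rewrite -[f in LHS]scale1r rkhs_ip_linear// mul1r.
Qed.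

Lemma rkhs_ip0l h : V h -> ip 0 h = 0.
Proof.
move=> Vh; have := rkhs_ipDl (rkhs0 H) (rkhs0 H) Vh.
by rewrite addr0 => /eqP; rewrite -subr_eq subrr => /eqP ->.
Qed.

Lemma rkhs_ipZl a f h : V f -> V h -> ip (a *: f) h = a * ip f h.
Proof.
move=> Vf Vh; rewrite -[a *: f]addr0 rkhs_ip_linear ?rkhs_ip0l ?addr0//.
exact: rkhs0.
Qed.

Lemma rkhs_ipDr f g h : V f -> V g -> V h -> ip h (f + g) = ip h f + ip h g.
Proof.
move=> Vf Vg Vh; have VD := rkhsD Vf Vg.
by rewrite rkhs_ipC// rkhs_ipDl// [ip f h]rkhs_ipC// [ip g h]rkhs_ipC.
Qed.

Lemma rkhs_ipZr a f h : V f -> V h -> ip h (a *: f) = a * ip h f.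
Proof.
move=> Vf Vh; have VZ := rkhsZ a Vf.
by rewrite rkhs_ipC// rkhs_ipZl// [ip f h]rkhs_ipC.
Qed.

Lemma rkhs_ip_ge0 f : V f -> 0 <= ip f f.
Proof.
move=> Vf; have [->|/eqP f0] := eqVneq f 0; last exact/ltW/rkhs_ip_gt0.
by rewrite rkhs_ip0l//; exact: rkhs0.
Qed.

Lemma rkhs_norm_ge0 f : 0 <= nrm f.
Proof. exact: sqrtr_ge0. Qed.

Lemma sqr_rkhs_norm f : V f -> nrm f ^+ 2 = ip f f.
Proof. by move=> Vf; rewrite sqr_sqrtr// rkhs_ip_ge0. Qed.

Lemma rkhs_norm0_eq0 f : V f -> nrm f = 0 -> f = 0.
Proof.
move=> Vf f0; apply: contrapT => /(rkhs_ip_gt0 Vf).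
by rewrite -sqr_rkhs_norm// f0 expr0n ltxx.
Qed.

Lemma sqr_rkhs_normDZ a f g : V f -> V g ->
  nrm (f + a *: g) ^+ 2 = nrm f ^+ 2 + 2 * a * ip f g + a ^+ 2 * nrm g ^+ 2.
Proof.
move=> Vf Vg; have Vag := rkhsZ a Vg.
rewrite !sqr_rkhs_norm//; last exact: rkhsD.
rewrite rkhs_ipDl//; last exact: rkhsD.
rewrite !rkhs_ipDr// !rkhs_ipZl// !rkhs_ipZr// [ip g f]rkhs_ipC//.
ring.
Qed.

(** The residue of the orthogonal projection of [f] onto the line of [g] has a
    nonnegative squared norm, which is |f|^2 - <f, g>^2 / |g|^2. *)
Lemma rkhs_Cauchy_Schwarz f g : V f -> V g -> `|ip f g| <= nrm f * nrm g.
Proof.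
move=> Vf Vg.
have [g0|g0] := eqVneq (nrm g) 0.
  rewrite g0 mulr0 (rkhs_norm0_eq0 Vg g0) rkhs_ipC//; last exact: rkhs0.
  by rewrite rkhs_ip0l// normr0.
rewrite -ler_sqr ?nnegrE ?mulr_ge0 ?rkhs_norm_ge0// real_normK ?num_real//.
have n0 : 0 < nrm g ^+ 2.
  by rewrite exprn_gt0// lt_neqAle eq_sym g0 rkhs_norm_ge0.
have := sqr_ge0 (nrm (f + (- ip f g / nrm g ^+ 2) *: g)).
rewrite sqr_rkhs_normDZ// exprMn -[ip f g ^+ 2 <= _]subr_ge0 => le0.
rewrite -(pmulr_lge0 _ n0) in le0; apply: le_trans le0 _; rewrite le_eqVlt.
by apply/orP; left; apply/eqP; field; rewrite g0.
Qed.

(** For [a = b = 1 / 2] this is the parallelogram identity; the negative last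
    term makes the squared norm strongly convex. *)
Lemma sqr_rkhs_norm_conv a b f g : a + b = 1 -> V f -> V g ->
  nrm (a *: f + b *: g) ^+ 2 =
  a * nrm f ^+ 2 + b * nrm g ^+ 2 - a * b * nrm (f - g) ^+ 2.
Proof.
move=> ab1 Vf Vg; have {ab1}-> : a = 1 - b by rewrite -ab1 addrK.
rewrite sqr_rkhs_normDZ//; last exact: rkhsZ.
rewrite rkhs_ipZl// -[_ *: f]add0r sqr_rkhs_normDZ//; last exact: rkhs0.
rewrite rkhs_ip0l// (sqr_rkhs_norm (rkhs0 H)) rkhs_ip0l; last exact: rkhs0.
rewrite -[- g]scaleN1r sqr_rkhs_normDZ//; ring.
Qed.

Lemma rkhs_conv a b f g : V f -> V g -> V (a *: f + b *: g).
Proof. by move=> Vf Vg; apply: rkhsD; exact: rkhsZ. Qed.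

(** Linearity and boundedness are required on the RKHS only: the functionals to
    come are integrals, which behave well on integrable functions only. *)
Record bounded_functional (l : (T -> R) -> R) : Prop := {
  functional_linear : forall a f g, V f -> V g ->
    l (a *: f + g) = a * l f + l g ;
  functional_bounded : exists M, forall f, V f -> `|l f| <= M * nrm f }.

Section bounded_functional_lemmas.
Variables (l : (T -> R) -> R) (bl : bounded_functional l).

Lemma functionalD f g : V f -> V g -> l (f + g) = l f + l g.
Proof.
by move=> Vf Vg; rewrite -[f in LHS]scale1r (functional_linear bl)// mul1r.
Qed.

Lemma functional0 : l 0 = 0.
Proof.
have := functionalD (rkhs0 H) (rkhs0 H).
by rewrite addr0 => /eqP; rewrite -subr_eq subrr => /eqP ->.
Qed.

Lemma functionalZ a f : V f -> l (a *: f) = a * l f.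
Proof.
move=> Vf; rewrite -[a *: f]addr0 (functional_linear bl)//; last exact: rkhs0.
by rewrite functional0 addr0.
Qed.

Lemma functionalB f g : V f -> V g -> l (f - g) = l f - l g.
Proof.
move=> Vf Vg; rewrite functionalD//; last exact: rkhsN.
by rewrite -scaleN1r functionalZ// mulN1r.
Qed.

Lemma functional_conv a b f g : V f -> V g ->
  l (a *: f + b *: g) = a * l f + b * l g.
Proof.
move=> Vf Vg; rewrite (functional_linear bl)// ?functionalZ//; exact: rkhsZ.
Qed.

Lemma functional_cvg (f_ : nat -> T -> R) g : (forall n, V (f_ n)) -> V g ->
  nrm (f_ n - g) @[n --> \oo] --> (0 : R) -> l (f_ n) @[n --> \oo] --> l g.
Proof.
move=> Vf Vg fg; have [M lM] := functional_bounded bl.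
apply: (@cvg_of_dist_le _ _ (fun n => M * nrm (f_ n - g))) => [n|].
  by rewrite -functionalB// lM//; exact: rkhsB.
by rewrite -(mulr0 M); exact: cvgZr.
Qed.

End bounded_functional_lemmas.

Lemma sqr_rkhs_norm_cvg (f_ : nat -> T -> R) g : (forall n, V (f_ n)) -> V g ->
  nrm (f_ n - g) @[n --> \oo] --> (0 : R) ->
  nrm (f_ n) ^+ 2 @[n --> \oo] --> nrm g ^+ 2.
Proof.
move=> Vf Vg fg.
apply: (@cvg_of_dist_le _ _
    (fun n => 2 * nrm g * nrm (f_ n - g) + nrm (f_ n - g) ^+ 2)) => [n|].
  have Vfg := rkhsB (Vf n) Vg.
  have -> : nrm (f_ n) ^+ 2 = nrm (g + 1 *: (f_ n - g)) ^+ 2.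
    by rewrite scale1r addrC subrK.
  rewrite sqr_rkhs_normDZ// mulr1 expr1n mul1r.
  rewrite [_ - _]addrC -addrA addKr (le_trans (ler_normD _ _))// lerD//.
    by rewrite normrM (@ger0_norm _ 2)// -mulrA ler_pM2l// rkhs_Cauchy_Schwarz.
  by rewrite ger0_norm// sqr_ge0.
rewrite [X in _ --> X](_ : 0 = 2 * nrm g * 0 + 0 * 0); last by ring.
by apply: cvgD; [exact: cvgZr|under eq_fun do rewrite expr2; exact: cvgM].
Qed.

(** The direct method: by strong convexity at midpoints, two near-minimizers are
    close to each other. Hence a minimizing sequence is a Cauchy sequence, whose
    limit is a minimizer, and two minimizers coincide. *)
Theorem unique_minimizer (C : set (T -> R)) (J : (T -> R) -> R) (c b : R) :
  C `<=` V -> C !=set0 ->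
  (forall f g, C f -> C g -> C (2^-1 *: f + 2^-1 *: g)) ->
  (forall (f_ : nat -> T -> R) g, (forall n, C (f_ n)) -> V g ->
    nrm (f_ n - g) @[n --> \oo] --> (0 : R) -> C g) ->
  (forall f, C f -> b <= J f) ->
  0 < c ->
  (forall f g, C f -> C g ->
    J (2^-1 *: f + 2^-1 *: g) <= (J f + J g) / 2 - c * nrm (f - g) ^+ 2) ->
  (forall (f_ : nat -> T -> R) g, (forall n, C (f_ n)) -> V g ->
    nrm (f_ n - g) @[n --> \oo] --> (0 : R) ->
    J (f_ n) @[n --> \oo] --> J g) ->
  exists g, unique (fun f => C f /\ forall h, C h -> J f <= J h) g.
Proof.
move=> CV [f0 Cf0] Cmid Ccl Jb c0 Jmid Jcvg.
pose m := inf (J @` C).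
have infJ : has_inf (J @` C).
  by split; [exists (J f0), f0|exists b => _ [f Cf <-]; exact: Jb].
have mJ f : C f -> m <= J f.
  by move=> Cf; apply: ge_inf; [case: infJ|exists f].
(* near-minimizers are close to each other, as their midpoint is no better than
   the infimum *)
have close f g e : C f -> C g -> J f < m + e -> J g < m + e ->
    c * nrm (f - g) ^+ 2 < e.
  move=> Cf Cg Jf Jg; have := Jmid _ _ Cf Cg; have := mJ _ (Cmid _ _ Cf Cg).
  move: (J (_ + _)) (c * _) => x z; lra.
have /choice[f_ f_P] n : exists f, C f /\ J f < m + n.+1%:R^-1.
  have [|_ [f Cf <-] Jf] := @inf_adherent _ (J @` C) n.+1%:R^-1 _ infJ.
    by rewrite invr_gt0.
  by exists f.
have Cf n : C (f_ n) by have [] := f_P n.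
have [e e0|g Vg fg] := @rkhs_complete _ _ _ H f_ (fun n => CV _ (Cf n)).
  have ce0 : 0 < c * e ^+ 2 by rewrite mulr_gt0// exprn_gt0.
  pose N := Num.truncn (c * e ^+ 2)^-1.
  have Ne : N.+1%:R^-1 <= c * e ^+ 2.
    by rewrite -[leRHS]invrK lef_pV2 ?posrE ?invr_gt0// ltW// truncnS_gt.
  exists N => p q Np Nq.
  rewrite -/(rkhs_norm H _) -(@ltr_sqr _ (nrm _)) ?nnegrE ?rkhs_norm_ge0 ?ltW//.
  rewrite -(ltr_pM2l c0) (lt_le_trans _ Ne)// close//.
    have [_ /lt_le_trans->//] := f_P p.
    by rewrite lerD2l lef_pV2 ?posrE// ler_nat ltnS.
  have [_ /lt_le_trans->//] := f_P q.
  by rewrite lerD2l lef_pV2 ?posrE// ler_nat ltnS.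
have Cg : C g by apply: Ccl fg.
have Jgm : J g <= m.
  apply: (@ler_cvg_to _ (\oo)%classic _ _ (J \o f_) (fun n => m + harmonic n))
    (Jcvg _ _ Cf Vg fg) _ _.
    rewrite -[X in _ --> X]addr0.
    by apply: cvgD; [exact: cvg_cst|exact: cvg_harmonic].
  by apply: nearW => n /=; apply/ltW; have [] := f_P n.
exists g; split=> [|h [Ch hmin]]; first by split=> // h /mJ; exact: le_trans.
apply/eqP; rewrite -subr_eq0; apply/eqP/rkhs_norm0_eq0.
  exact: rkhsB (CV _ _) (CV _ _).
apply/eqP; rewrite -sqrf_eq0 eq_le sqr_ge0 andbT -(ler_pM2l c0) mulr0.
have := Jmid _ _ Cg Ch; have := mJ _ (Cmid _ _ Cg Ch); have := hmin _ Cg.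
move: (J (_ + _)) (c * _) => x z; lra.
Qed.

(** If [l] is represented by r, then |f|^2 - 2 l(f) = |f - r|^2 - |r|^2. This
    function of f therefore determines r as its minimizer, which exists by
    [unique_minimizer]; the stationarity of the function at its minimizer is
    the identity to prove. *)
Theorem Riesz_representation l : bounded_functional l ->
  exists2 r, V r & forall f, V f -> l f = ip f r.
Proof.
move=> bl; have [M lM] := functional_bounded bl.
pose J f := nrm f ^+ 2 - 2 * l f.
have [||||||f g Vf Vg|f_ g Vf Vg fg|r [[Vr rmin] _]] :=
    @unique_minimizer V J 4^-1 (- M ^+ 2).
- by [].
- by exists 0; exact: rkhs0.
- by move=> f g; exact: rkhs_conv.
- by [].
- move=> f Vf; have := lM f Vf; rewrite ler_norml => /andP[_ lf].
  have := sqr_ge0 (nrm f - M); rewrite /J; lra.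
- by rewrite invr_gt0.
- rewrite /J sqr_rkhs_norm_conv//; last lra.
  rewrite (functional_conv bl)//; lra.
- rewrite /J; apply: cvgB; first exact: sqr_rkhs_norm_cvg.
  by apply: cvgZr; exact: functional_cvg.
exists r => // f Vf; apply/eqP; rewrite -subr_eq0 [ip f r]rkhs_ipC//.
set d := l f - ip r f; set n := nrm f ^+ 2.
have n0 : 0 <= n by exact: sqr_ge0.
(* a step along f which decreases J as soon as d is nonzero *)
have := rmin (r + (d / (n + 1)) *: f) (rkhsD Vr (rkhsZ _ Vf)).
rewrite /J sqr_rkhs_normDZ// (functionalD bl)//; last exact: rkhsZ.
rewrite (functionalZ bl)// -/n.
have -> : ip r f = l f - d by rewrite /d; lra.
have n1 : n + 1 != 0 by lra.
rewrite -subr_ge0 => le0.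
have : 0 <= - (d ^+ 2 * ((n + 2) / (n + 1) ^+ 2)).
  by apply: le_trans le0 _; rewrite le_eqVlt; apply/orP; left; apply/eqP; field.
rewrite oppr_ge0 pmulr_lle0 => [d0|]; last first.
  by rewrite divr_gt0// ?exprn_gt0//; lra.
by rewrite -sqrf_eq0 eq_le d0 sqr_ge0.
Qed.

End Hilbert.

(** * Discrete and continuous time as measure spaces *)

(** The common features of the two time sets. Times are the images by [pt] of
    the points of [dom]. Sums over time are Lebesgue integrals only for
    nonnegative or absolutely summable signals, hence the two laws on
    [time_integral]. The inputs are bounded almost everywhere only, because
    those of continuous time are elements of a Lebesgue space. *)
Record time_model (R : realType) (tk : time_kind) := {
  tm_disp : measure_display ;
  tm_type : measurableType tm_disp ;
  mu : {measure set tm_type -> \bar R} ;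
  dom : set tm_type ;
  pt : tm_type -> time R tk ;
  measurable_dom : measurable dom ;
  integrable_signalE : forall g : time R tk -> R,
    integrable_signal g <-> mu.-integrable dom (EFin \o (g \o pt)) ;
  time_integralE : forall g : time R tk -> R,
    integrable_signal g ->
    time_integral (EFin \o g) = (\int[mu]_(x in dom) (g (pt x))%:E)%E ;
  ge0_time_integralE : forall g : time R tk -> R, (forall t, 0 <= g t) ->
    time_integral (EFin \o g) = (\int[mu]_(x in dom) (g (pt x))%:E)%E ;
  continuous_measurable_pt : forall g : time R tk -> R, continuous g ->
    measurable_fun dom (g \o pt) ;
  measurable_input : forall (u : input_time R tk -> R) t, bounded_input u ->
    measurable_fun dom (fun x => u (time_sub t (pt x))) ;
  ae_bounded_input : forall (u : input_time R tk -> R), bounded_input u ->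
    exists M : R, forall t,
      {ae mu, forall x, dom x -> `|u (time_sub t (pt x))| <= M} }.

Section discrete.
Context (R : realType).

Lemma integrable_counting (g : nat -> R) :
  (@counting nat R).-integrable setT (EFin \o g) <->
  (\sum_(0 <= t <oo) `|g t|%:E < +oo)%E.
Proof.
rewrite -(@ge0_integral_count _ (fun t => `|g t|%:E))//.
by split => [/integrableP[_]//|gfin]; apply/integrableP; split.
Qed.

Definition discrete_model : time_model R discrete_time.
Proof.
refine (@Build_time_model R discrete_time _ nat (@counting nat R) setT id
  measurableT _ _ _ _ _ _).
- by move=> g; split=> /integrable_counting.
- move=> g gint; rewrite /= integral_count//.
  by rewrite /summable -nneseries_esumT//; exact: gint.
- by move=> g g0; rewrite /= ge0_integral_count.
- by [].
- by [].
- by move=> u [M uM]; exists M => t; apply: nearW => x _; exact: uM.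
Defined.

End discrete.

Section continuous.
Context (R : realType).
Local Notation half_line := (`[0 : R, +oo[%classic).
Local Notation leb := (@lebesgue_measure R).

Lemma zero_half_line : 0 \in half_line.
Proof. by rewrite inE/= in_itv/= lexx. Qed.

(** The value outside the half-line is junk, like that of [valL_]. *)
Definition half_line_pt (x : R) : half_line := insubd (SigSub zero_half_line) x.

Lemma val_half_line_pt x : half_line x -> val (half_line_pt x) = x.
Proof. by move=> /mem_set xD; rewrite /half_line_pt insubdK. Qed.

Lemma valL_half_line_pt (V : Type) (v : V) (g : half_line -> V) x :
  half_line x -> valL_ v g x = g (half_line_pt x).
Proof.
move=> /mem_set xD; rewrite /= oinv_set_val insubT/=; congr g; apply/val_inj.
by rewrite /= val_half_line_pt//; exact/set_mem.
Qed.

Definition reflection (t : R) (x : measurableTypeR R) : measurableTypeR R :=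
  t - x.

Lemma measurable_reflection t : measurable_fun setT (reflection t).
Proof.
apply: continuous_measurable_fun => x.
by apply: cvgB; [exact: cvg_cst|exact: cvg_id].
Qed.

#[local] HB.instance Definition _ t :=
  isMeasurableFun.Build _ _ _ _ (reflection t) (measurable_reflection t).

(** By uniqueness of the Lebesgue measure, as a reflection permutes the bounded
    intervals and preserves their lengths. *)
Lemma lebesgue_measure_reflection t (A : set (measurableTypeR R)) :
  measurable A -> leb (reflection t @^-1` A) = leb A.
Proof.
move=> mA; rewrite -/(pushforward leb (reflection t) A).
apply/esym/lebesgue_measure_unique => //= [|mreflection _ [[a b] _ <-]].
  exact: measurable_reflection.
rewrite /pushforward/=.
have -> : reflection t @^-1` `]a, b]%classic = `[t - b, t - a[%classic.
  by apply/seteqP; split=> x /=; rewrite !in_itv/= /reflection;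
    move=> /andP[? ?]; apply/andP; split; lra.
rewrite !lebesgue_measure_itv/= !lte_fin ltrD2l ltrN2.
by case: ifPn => // _; rewrite -!EFinD; congr EFin; ring.
Qed.

(** This turns the essential boundedness of an input u into that of the
    integrand u(t - s) of the output at time t. *)
Lemma ae_reflection t (P : set (measurableTypeR R)) :
  {ae leb, forall x, P x} -> {ae leb, forall x, P (t - x)}.
Proof.
move=> [N [mN N0 PN]]; exists (reflection t @^-1` N); split.
- by rewrite -[X in measurable X]setTI; exact: measurable_reflection.
- by rewrite lebesgue_measure_reflection.
- by move=> x /= /PN.
Qed.

Lemma Lfun_infty_ae_bounded (u : R -> R) : u \in Lfun leb +oo%E ->
  exists M : R, {ae leb, forall x, `|u x| <= M}.
Proof.
move=> /andP[_]; rewrite inE/= /finite_norm unlock/=.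
rewrite ifT; last first.
  by rewrite -set_itvNyy lebesgue_measure_itv/= addye// ltry.
move=> uoo.
have [M /ess_supP uM] : exists M : R,
    (ess_sup leb (abse \o (EFin \o u)) <= M%:E)%E.
  case: (ess_sup _ _) uoo => [r _|//|_]; first by exists r.
  by exists 0; exact: leNye.
by exists M; apply: filterS uM => x /=; rewrite lee_fin.
Qed.

Definition continuous_model : time_model R continuous_time.
Proof.
refine (@Build_time_model R continuous_time _ (measurableTypeR R) leb half_line
  half_line_pt (measurable_itv _) _ _ _ _ _ _).
- move=> g; split=> /= h; apply: eq_integrable h => // x /set_mem xD /=;
    by rewrite -(valL_half_line_pt 0 g xD).
- by move=> g _; apply: eq_integral => x /set_mem xD; rewrite valL_half_line_pt.
- by move=> g _; apply: eq_integral => x /set_mem xD; rewrite valL_half_line_pt.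
- move=> g cg.
  apply: (@eq_measurable_fun _ _ _ _ _ (valL_ 0 g)) => [x /set_mem xD|].
    by rewrite valL_half_line_pt.
  apply: subspace_continuous_measurable_fun => //.
  exact/subspace_valL_continuousP'.
- move=> u t /= /andP[+ _]; rewrite inE/= => mu.
  apply: (@eq_measurable_fun _ _ _ _ _ (u \o reflection (val t)))
      => [x /set_mem xD|].
    by rewrite /= val_half_line_pt.
  apply: (measurableT_comp mu); apply: measurable_funTS.
  exact: measurable_reflection.
- move=> u /Lfun_infty_ae_bounded[M uM]; exists M => t.
  have [N [mN N0 uN]] := ae_reflection (val t) uM.
  exists N; split=> // x; apply: contra_notP => Nx xD.
  by rewrite /= -/(val _) val_half_line_pt//; apply: contrapT => /uN.
Defined.

End continuous.

Definition model_of_time (R : realType) (tk : time_kind) : time_model R tk :=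
  match tk with
  | discrete_time => discrete_model R
  | continuous_time => continuous_model R
  end.

(** * Integrals of signals *)

Lemma dist_le_of_derive_le1 (R : realType) (f df : R -> R) (a b : R) :
  (forall x : R, is_derive x (1 : R) f (df x)) -> (forall x, `|df x| <= 1) ->
  `|f a - f b| <= `|a - b|.
Proof.
move=> fd df1; wlog ba : a b / b <= a => [H|].
  by have [/H//|/ltW/H] := leP b a; rewrite distrC [leRHS]distrC.
have [|x _ ->] := MVT_segment ba (fun x _ => fd x).
  by apply: derivable_within_continuous => x _; have [] := fd x.
by rewrite normrM ler_piMl.
Qed.

Lemma dist_cos_le (R : realType) (a b : R) : `|cos a - cos b| <= `|a - b|.
Proof.
apply: (@dist_le_of_derive_le1 _ cos (fun x => - sin x)) => x.
by rewrite normrN sin_max.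
Qed.

Lemma dist_sin_le (R : realType) (a b : R) : `|sin a - sin b| <= `|a - b|.
Proof. by apply: (@dist_le_of_derive_le1 _ sin cos) => x; rewrite cos_max. Qed.

Lemma continuous_time_val (R : realType) tk : continuous (@time_val R tk).
Proof.
case: tk => t; last exact: initial_continuous.
move=> U /nbhs_singleton Ut; apply: open_nbhs_nbhs; split=> //.
exact: discrete_open.
Qed.

Lemma time_val_ge0 (R : realType) tk (t : time R tk) : 0 <= time_val t.
Proof.
by case: tk t => //= t; have := valP t; rewrite inE/= in_itv/= andbT.
Qed.

Section signals.
Context (R : realType) (tk : time_kind) (X : time_model R tk).
Implicit Types (f g m w : time R tk -> R) (a b M : R).

Local Notation mu := (@mu _ _ X).
Local Notation dom := (@dom _ _ X).
Local Notation pt := (@pt _ _ X).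

Lemma integrable_signal_lin a f g :
  integrable_signal f -> integrable_signal g -> integrable_signal (a *: f + g).
Proof.
move=> /(integrable_signalE X) fi /(integrable_signalE X) gi.
apply/(integrable_signalE X).
have mD := measurable_dom X.
apply: eq_integrable (integrableD mD (integrableZl mD a fi) gi) => //.
Qed.

Lemma time_RintegralE f : integrable_signal f ->
  time_Rintegral f = \int[mu]_(x in dom) f (pt x).
Proof.
by move=> fi; rewrite /time_Rintegral -/(EFin \o f) (time_integralE X).
Qed.

Lemma time_Rintegral_lin a f g :
  integrable_signal f -> integrable_signal g ->
  time_Rintegral (a *: f + g) = a * time_Rintegral f + time_Rintegral g.
Proof.
move=> fi gi; rewrite !time_RintegralE//; last exact: integrable_signal_lin.
move: fi gi => /(integrable_signalE X) fi /(integrable_signalE X) gi.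
have mD := measurable_dom X.
rewrite -RintegralZl// -RintegralD//.
exact: eq_integrable (integrableZl mD a fi).
Qed.

Lemma integrable_signalZ a f :
  integrable_signal f -> integrable_signal (a *: f).
Proof.
move=> fi; rewrite -(subrK 1 a) scalerDl scale1r.
exact: integrable_signal_lin.
Qed.

Lemma time_RintegralZ a f : integrable_signal f ->
  time_Rintegral (a *: f) = a * time_Rintegral f.
Proof.
move=> fi; rewrite -{1}(subrK 1 a) scalerDl scale1r time_Rintegral_lin//.
by rewrite mulrBl mul1r subrK.
Qed.

(** The factors by which integrable signals are multiplied: a trigonometric
    function for the Fourier transform, a reflected input for an output. *)
Definition multiplier m M := [/\ 0 <= M, measurable_fun dom (m \o pt) &
  {ae mu, forall x, dom x -> `|m (pt x)| <= M}].

Lemma continuous_multiplier m M : continuous m -> (forall t, `|m t| <= M) ->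
  multiplier m M.
Proof.
move=> cm mM; split; first exact: le_trans (mM (pt point)).
  exact: continuous_measurable_pt.
by apply: nearW => x _.
Qed.

Lemma measurable_signal f : integrable_signal f -> measurable_fun dom (f \o pt).
Proof.
by move=> /(integrable_signalE X)/measurable_int/measurable_EFinP.
Qed.

Lemma le_integral_abs_signal f w M : 0 <= M ->
  measurable_fun dom (f \o pt) -> measurable_fun dom (w \o pt) ->
  (forall t, 0 <= w t) ->
  {ae mu, forall x, dom x -> `|f (pt x)| <= M * w (pt x)} ->
  (\int[mu]_(x in dom) `|f (pt x)|%:E <=
    M%:E * \int[mu]_(x in dom) (w (pt x))%:E)%E.
Proof.
move=> M0 mf mw w0 fw; have mD := measurable_dom X.
rewrite -ge0_integralZl_EFin//; first last.
- exact/measurable_EFinP.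
- by move=> x _; rewrite lee_fin.
apply: ae_ge0_le_integral => //.
- by apply/measurable_EFinP; exact: measurableT_comp.
- by move=> x _; rewrite -EFinM lee_fin mulr_ge0.
- by apply: measurable_funeM; exact/measurable_EFinP.
Qed.

Lemma integrable_signalM g m M : integrable_signal g -> multiplier m M ->
  integrable_signal (fun t => g t * m t).
Proof.
move=> gi [M0 mm mM]; have mg := measurable_signal gi.
apply/(integrable_signalE X)/integrableP.
have mgm : measurable_fun dom ((fun t => g t * m t) \o pt).
  exact: measurable_funM.
split; first exact/measurable_EFinP.
have := @le_integral_abs_signal _ (fun t => `|g t|) M M0 mgm.
move=> /(_ _ _ _)/le_lt_trans; apply.
- exact: measurableT_comp.
- by [].
- apply: filterS mM => x mM xD; rewrite normrM mulrC ler_wpM2r//; exact: mM.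
move: gi => /(integrable_signalE X)/integrableP[_ gi].
by apply: lte_mul_pinfty.
Qed.

(** For [w] the product of a power of time and of k(t,t)^(1/2), the integral on
    the right is a moment of the kernel. *)
Lemma normr_time_Rintegral_le f w M : 0 <= M -> integrable_signal f ->
  continuous w -> (forall t, 0 <= w t) ->
  (time_integral (EFin \o w) < +oo)%E ->
  {ae mu, forall x, dom x -> `|f (pt x)| <= M * w (pt x)} ->
  `|time_Rintegral f| <= M * fine (time_integral (EFin \o w)).
Proof.
move=> M0 fi cw w0 woo fw; have mD := measurable_dom X.
have mw : measurable_fun dom (w \o pt) := continuous_measurable_pt cw.
have wge0 : (0 <= time_integral (EFin \o w))%E.
  rewrite (ge0_time_integralE X)//.
  by apply: integral_ge0 => x _; rewrite lee_fin.
rewrite time_RintegralE// -lee_fin EFin_normr_Rintegral//; last first.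
  exact/(integrable_signalE X).
rewrite EFinM fineK ?ge0_fin_numE// (ge0_time_integralE X)//.
apply: le_trans (le_integral_abs_signal M0 (measurable_signal fi) mw w0 fw).
apply: le_abse_integral => //; apply/measurable_EFinP; exact: measurable_signal.
Qed.

End signals.

(** * The functionals of the problem *)

(** The real and imaginary parts of the Fourier transform. *)
Definition cos_transform (R : realType) tk (w : R) (g : time R tk -> R) : R :=
  time_Rintegral (fun t => g t * cos (- (w * time_val t))).

Definition sin_transform (R : realType) tk (w : R) (g : time R tk -> R) : R :=
  time_Rintegral (fun t => g t * sin (- (w * time_val t))).

Lemma sqr_cmod_fourier (R : realType) tk (w : R) (g : time R tk -> R) :
  cmod (fourier w g) ^+ 2 = cos_transform w g ^+ 2 + sin_transform w g ^+ 2.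
Proof.
rewrite /fourier /time_Cintegral /=.
rewrite sqr_sqrtr; last by rewrite addr_ge0 ?sqr_ge0.
congr (_ ^+ 2 + _ ^+ 2); congr time_Rintegral; apply/funext => t /=.
  by rewrite mul0r subr0.
by rewrite mul0r addr0.
Qed.

Section stable_rkhs.
Context (R : realType) (tk : time_kind) (X : time_model R tk).
Context (k : time R tk -> time R tk -> R) (H : rkhs k).
Hypothesis mercer : mercer_kernel k.
Hypothesis stable : stable_kernel H.
Hypothesis moment0 : (kernel_moment k 0 < +oo)%E.
Hypothesis moment1 : (kernel_moment k 1 < +oo)%E.
Local Notation V := (rkhs_space H).
Local Notation ip := (rkhs_ip H).
Local Notation nrm := (rkhs_norm H).
Local Notation mom n := (fine (kernel_moment k n)).
Implicit Types (f g m : time R tk -> R) (a b w M : R).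

Let weight n (t : time R tk) : R := time_val t ^+ n * Num.sqrt (k t t).

Let weight_ge0 n t : 0 <= weight n t.
Proof. by rewrite mulr_ge0 ?sqrtr_ge0 ?exprn_ge0 ?time_val_ge0. Qed.

Let weight_continuous n : continuous (weight n).
Proof.
move=> t; apply: cvgM.
  apply: (@continuous_comp _ _ _ (@time_val R tk) (fun x : R => x ^+ n)).
    exact: continuous_time_val.
  exact: exprn_continuous.
apply: (@continuous_comp _ _ _ (fun t => k t t) (@Num.sqrt R)).
  apply: (@continuous_comp _ _ _ (fun t => (t, t)) (fun st => k st.1 st.2)).
    by apply: cvg_pair; exact: cvg_id.
  exact: mercer_continuous.
exact: sqrt_continuous.
Qed.

Lemma kernel_moment_ge0 n : (0 <= kernel_moment k n)%E.
Proof.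
rewrite /kernel_moment -/(EFin \o weight n) (ge0_time_integralE X)//.
by apply: integral_ge0 => x _; rewrite lee_fin.
Qed.

Lemma fineK_kernel_moment n : (kernel_moment k n < +oo)%E ->
  (mom n)%:E = kernel_moment k n.
Proof. by move=> noo; rewrite fineK// ge0_fin_numE// kernel_moment_ge0. Qed.

Lemma normr_eval_le g t : V g -> `|g t| <= nrm g * Num.sqrt (k t t).
Proof.
move=> Vg; rewrite -(rkhs_reproducing t Vg).
have Vk := rkhs_section H t.
by rewrite (le_trans (rkhs_Cauchy_Schwarz Vg Vk))// /rkhs_norm rkhs_reproducing.
Qed.

(** The bound |g(t)| <= |g| k(t,t)^(1/2), integrated against [m]: [n = 0] serves
    for the bounds on transforms and outputs, [n = 1] for their dependence on
    the frequency. *)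
Lemma normr_time_Rintegral_rkhs_le n g m M : V g -> 0 <= M ->
  (kernel_moment k n < +oo)%E -> integrable_signal (fun t => g t * m t) ->
  {ae mu X, forall x, dom x -> `|m (pt x)| <= M * time_val (pt x) ^+ n} ->
  `|time_Rintegral (fun t => g t * m t)| <= nrm g * M * mom n.
Proof.
move=> Vg M0 noo gmi mM.
apply: (@normr_time_Rintegral_le _ _ X _ (weight n)) => //.
- by rewrite mulr_ge0// rkhs_norm_ge0.
- apply: filterS mM => x mM xD; rewrite normrM.
  have -> : nrm g * M * weight n (pt x) =
      nrm g * Num.sqrt (k (pt x) (pt x)) * (M * time_val (pt x) ^+ n).
    by rewrite /weight; ring.
  by apply: ler_pM => //; [exact: normr_eval_le|exact: mM].
Qed.

Lemma multiplier_functional m M : multiplier X m M ->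
  bounded_functional H (fun g => time_Rintegral (fun t => g t * m t)).
Proof.
move=> mM; have int g : V g -> integrable_signal (fun t => g t * m t).
  by move=> /stable gi; exact: integrable_signalM mM.
split=> [a f g Vf Vg|].
  rewrite -(time_Rintegral_lin X)//; [|exact: int|exact: int].
  congr time_Rintegral; apply/funext => t /=; rewrite mulrDl.
  by congr (_ + _); exact/esym/mulrA.
have [M0 _ aem] := mM.
exists (M * mom 0) => g Vg; rewrite mulrC mulrA.
apply: normr_time_Rintegral_rkhs_le => //; first exact: int.
by apply: filterS aem => x + xD; rewrite expr0 mulr1; exact.
Qed.

Lemma output_functional (u : input_time R tk -> R) t : bounded_input u ->
  bounded_functional H (system_output u t).
Proof.
move=> bu; have [M uM] := ae_bounded_input X bu.
apply: (@multiplier_functional (fun s => u (time_sub t s)) `|M|); split=> //.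
- exact: measurable_input.
- apply: filterS (uM t) => x + xD => /(_ xD)/le_trans; apply.
  exact: ler_norm.
Qed.

Lemma cos_multiplier w :
  multiplier X (fun t => cos (- (w * time_val t))) 1.
Proof.
apply: continuous_multiplier => t; last exact: cos_max.
apply: (@continuous_comp _ _ _ (@time_val R tk) (fun x => cos (- (w * x)))).
  exact: continuous_time_val.
apply: continuous_comp; last exact: continuous_cos.
by apply: cvgN; apply: cvgMr; exact: cvg_id.
Qed.

Lemma sin_multiplier w :
  multiplier X (fun t => sin (- (w * time_val t))) 1.
Proof.
apply: continuous_multiplier => t; last exact: sin_max.
apply: (@continuous_comp _ _ _ (@time_val R tk) (fun x => sin (- (w * x)))).
  exact: continuous_time_val.
apply: continuous_comp; last exact: continuous_sin.
by apply: cvgN; apply: cvgMr; exact: cvg_id.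
Qed.

Lemma cos_functional w : bounded_functional H (cos_transform w).
Proof. exact: multiplier_functional (cos_multiplier w). Qed.

Lemma sin_functional w : bounded_functional H (sin_transform w).
Proof. exact: multiplier_functional (sin_multiplier w). Qed.

(** [e] is the cosine or the sine. *)
Section Lipschitz.
Variable e : R -> R.
Hypothesis e_le1 : forall x, `|e x| <= 1.
Hypothesis e_lip : forall x y, `|e x - e y| <= `|x - y|.
Hypothesis e_mult : forall w,
  multiplier X (fun t => e (- (w * time_val t))) 1.

Let transform w g := time_Rintegral (fun t => g t * e (- (w * time_val t))).

Let integrable_transform w g : V g ->
  integrable_signal (fun t => g t * e (- (w * time_val t))).
Proof. by move=> /stable gi; exact: integrable_signalM (e_mult w). Qed.

Let normr_transform_le w g : V g -> `|transform w g| <= nrm g * mom 0.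
Proof.
move=> Vg; rewrite -[nrm g]mulr1.
apply: normr_time_Rintegral_rkhs_le => //; first exact: integrable_transform.
by apply: nearW => x _; rewrite expr0 mulr1.
Qed.

Let dist_transform_le w v g : V g ->
  `|transform w g - transform v g| <= nrm g * `|w - v| * mom 1.
Proof.
move=> Vg; have iw := integrable_transform w Vg.
have iv := integrable_transform v Vg.
pose m (t : time R tk) := e (- (w * time_val t)) - e (- (v * time_val t)).
have mE : (fun t => g t * m t) =
    (-1) *: (fun t => g t * e (- (v * time_val t))) +
    (fun t => g t * e (- (w * time_val t))).
  by apply/funext => t /=; rewrite mulrBr scaleN1r addrC.
have -> : transform w g - transform v g = time_Rintegral (fun t => g t * m t).
  by rewrite mE (time_Rintegral_lin X)// mulN1r addrC.
apply: normr_time_Rintegral_rkhs_le => //.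
  by rewrite mE; exact: integrable_signal_lin.
apply: nearW => x _; apply: le_trans (e_lip _ _) _.
by rewrite opprK addrC -mulrBl normrM distrC expr1 (ger0_norm (time_val_ge0 _)).
Qed.

Lemma dist_sqr_transform_le w v g : V g ->
  `|transform w g ^+ 2 - transform v g ^+ 2| <=
  2 * mom 0 * mom 1 * nrm g ^+ 2 * `|w - v|.
Proof.
move=> Vg; rewrite subr_sqr normrM.
have -> : 2 * mom 0 * mom 1 * nrm g ^+ 2 * `|w - v| =
    (nrm g * `|w - v| * mom 1) * (nrm g * mom 0 + nrm g * mom 0) by ring.
apply: ler_pM => //; first exact: dist_transform_le.
by apply: le_trans (ler_normD _ _) _; apply: lerD; exact: normr_transform_le.
Qed.

End Lipschitz.

(** Each of the real and imaginary parts of the Fourier transform is bounded by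
    mu_0 |g| and (mu_1 |g|)-Lipschitz in the frequency; its square is therefore
    (2 mu_0 mu_1 |g|^2)-Lipschitz. *)
Lemma dist_sqr_cmod_fourier_le w v g : V g ->
  `|cmod (fourier w g) ^+ 2 - cmod (fourier v g) ^+ 2| <=
  4 * mom 0 * mom 1 * nrm g ^+ 2 * `|w - v|.
Proof.
move=> Vg; rewrite !sqr_cmod_fourier opprD addrACA.
have := dist_sqr_transform_le (@cos_max R) (@dist_cos_le R) cos_multiplier
  w v Vg.
have := dist_sqr_transform_le (@sin_max R) (@dist_sin_le R) sin_multiplier
  w v Vg.
rewrite -/(sin_transform _ _) -/(sin_transform _ _).
rewrite -/(cos_transform _ _) -/(cos_transform _ _) => les lec.
apply: le_trans (ler_normD _ _) _; apply: le_trans (lerD lec les) _.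
by rewrite le_eqVlt; apply/orP; left; apply/eqP; ring.
Qed.

(** Let rc and rs be the Riesz representers of the cosine and sine transforms.
    Since rc(t) and rs(t) are the transforms of the section of [k] at t, the
    addition formula for the cosine identifies |rc|^2 + |rs|^2 with the real
    part of the iterated integral of [k]. On the other hand
    q = |F_w(g)|^2 is the inner product of g and Re F_w(g) rc + Im F_w(g) rs,
    whose squared norm is at most q (|rc|^2 + |rs|^2), so that
    q^2 <= |g|^2 q (|rc|^2 + |rs|^2). *)
Lemma sqr_cmod_fourier_le_kernel_fourier w g : V g ->
  cmod (fourier w g) ^+ 2 <= nrm g ^+ 2 * cmod (kernel_fourier k w).
Proof.
move=> Vg; have [rc Vrc rcE] := Riesz_representation (cos_functional w).
have [rs Vrs rsE] := Riesz_representation (sin_functional w).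
have evalE r l t : V r -> (forall f, V f -> l f = ip f r) -> r t = l (k t).
  move=> Vr lE; have Vk := rkhs_section H t.
  by rewrite lE// rkhs_ipC// rkhs_reproducing.
have intc f : V f ->
    integrable_signal (fun t => f t * cos (- (w * time_val t))).
  by move=> /stable fi; exact: integrable_signalM (cos_multiplier w).
have ints f : V f ->
    integrable_signal (fun t => f t * sin (- (w * time_val t))).
  by move=> /stable fi; exact: integrable_signalM (sin_multiplier w).
have sectionE t :
    time_Rintegral (fun s => k s t * cos (- (w * (time_val s - time_val t)))) =
    rc t * cos (- (w * time_val t)) + rs t * sin (- (w * time_val t)).
  have Vk := rkhs_section H t.
  have rcC := evalE rc (cos_transform w) t Vrc rcE.
  have rsC := evalE rs (sin_transform w) t Vrs rsE.
  rewrite rcC rsC [X in X + _]mulrC [X in _ + X]mulrC.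
  rewrite -(time_RintegralZ X _ (ints _ Vk)).
  rewrite -(time_Rintegral_lin X _ (intc _ Vk)); last first.
    by apply: (integrable_signalZ X); exact: ints.
  congr time_Rintegral; apply/funext => s; rewrite (mercer_sym mercer).
  have -> : - (w * (time_val s - time_val t)) =
      - (w * time_val s) - - (w * time_val t) by ring.
  rewrite cosB mulrDr; congr (_ + _); rewrite mulrA mulrC//.
have kernelE : complex.Re (kernel_fourier k w) = nrm rc ^+ 2 + nrm rs ^+ 2.
  rewrite !sqr_rkhs_norm// -rcE// -rsE//.
  rewrite -[cos_transform w rc]mul1r -(time_Rintegral_lin X); last 2 first.
  - exact: intc.
  - exact: ints.
  rewrite /kernel_fourier /time_Cintegral/=; congr time_Rintegral.
  apply/funext => t /=; rewrite scale1r -[RHS]sectionE.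
  by congr time_Rintegral; apply/funext => s; rewrite mul0r subr0.
(* the difference of the two sides is |b rc - a rs|^2 *)
have le_norm2 (a b : R) :
    nrm (a *: rc + b *: rs) ^+ 2 <=
    (a ^+ 2 + b ^+ 2) * (nrm rc ^+ 2 + nrm rs ^+ 2).
  have Vac := rkhsZ a Vrc; have Vas := rkhsZ (- a) Vrs.
  have Vbc := rkhsZ b Vrc.
  have := sqr_ge0 (nrm (b *: rc + (- a) *: rs)).
  rewrite !sqr_rkhs_normDZ// !rkhs_ipZl//.
  have sqrZ c : nrm (c *: rc) ^+ 2 = c ^+ 2 * nrm rc ^+ 2.
    by rewrite !sqr_rkhs_norm ?rkhs_ipZl ?rkhs_ipZr//; [ring|exact: rkhsZ..].
  rewrite !sqrZ => ge0; rewrite -subr_ge0; apply: le_trans ge0 _.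
  by rewrite le_eqVlt; apply/orP; left; apply/eqP; ring.
rewrite sqr_cmod_fourier.
set a := cos_transform w g; set b := sin_transform w g.
set q := a ^+ 2 + b ^+ 2.
have q0 : 0 <= q by rewrite addr_ge0 ?sqr_ge0.
have Vab := rkhs_conv a b Vrc Vrs.
have qE : q = ip g (a *: rc + b *: rs).
  have Vac := rkhsZ a Vrc; have Vbs := rkhsZ b Vrs.
  by rewrite rkhs_ipDr// !rkhs_ipZr// -rcE// -rsE.
have ReK : nrm rc ^+ 2 + nrm rs ^+ 2 <= cmod (kernel_fourier k w).
  rewrite -kernelE; case: (kernel_fourier k w) => x z /=.
  rewrite (le_trans (ler_norm x))// -sqrtr_sqr ler_wsqrtr// lerDl sqr_ge0//.
have [->|qneq0] := eqVneq q 0.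
  by rewrite mulr_ge0 ?sqr_ge0// (le_trans _ ReK)// addr_ge0 ?sqr_ge0.
have qgt0 : 0 < q by rewrite lt_neqAle eq_sym qneq0.
rewrite -(ler_pM2l qgt0) -expr2.
apply: (@le_trans _ _ (nrm g ^+ 2 * nrm (a *: rc + b *: rs) ^+ 2)).
  rewrite -exprMn ler_sqr ?nnegrE ?mulr_ge0 ?rkhs_norm_ge0//.
  by apply: le_trans (rkhs_Cauchy_Schwarz Vg Vab); rewrite -qE ler_norm.
rewrite [leRHS]mulrCA ler_wpM2l ?sqr_ge0//.
by apply: le_trans (le_norm2 _ _) _; rewrite ler_pM2l.
Qed.

End stable_rkhs.

(** * Points of a partition *)

Lemma mesh_cons2 (R : realType) (a b : R) (s : seq R) :
  mesh [:: a, b & s] = Num.max `|b - a| (mesh (b :: s)).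
Proof. by rewrite /mesh big_ord_recl. Qed.

Lemma mesh_ge0 (R : realType) (s : seq R) : 0 <= mesh s.
Proof. by apply: bigmax_ge_id. Qed.

(** A point between two neighbours is at most half-way from the nearer one. *)
Lemma near_partition_point (R : realType) (a w : R) (s : seq R) :
  a <= w <= last a s ->
  exists2 v, v \in a :: s & `|w - v| <= mesh (a :: s) / 2.
Proof.
elim: s a => [|b s IH] a /= /andP[aw ws].
  exists a; first by rewrite mem_seq1.
  have -> : w = a by apply/le_anti/andP.
  by rewrite subrr normr0 divr_ge0 ?mesh_ge0.
have [bw|wb] := leP b w.
  have [|v vs wv] := IH b; first by rewrite bw.
  exists v; first by rewrite in_cons vs orbT.
  apply: le_trans wv _.
  by rewrite mesh_cons2 ler_pM2r ?invr_gt0// le_max lexx orbT.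
have ab : 0 <= b - a by rewrite subr_ge0 (le_trans aw)// ltW.
have le_mesh (x : R) : x <= (b - a) / 2 -> x <= mesh [:: a, b & s] / 2.
  move=> /le_trans; apply; rewrite mesh_cons2 ler_pM2r ?invr_gt0// le_max.
  by rewrite (ger0_norm ab) lexx.
have [wa|wa] := leP (w - a) ((b - a) / 2).
  exists a; first exact: mem_head.
  by rewrite ger0_norm ?subr_ge0//; exact: le_mesh.
exists b; first by rewrite !in_cons eqxx orbT.
have wb0 : 0 <= b - w by rewrite subr_ge0 ltW.
by rewrite distrC ger0_norm//; apply: le_mesh; lra.
Qed.

(** * The identification problem *)

Lemma sqr_conv_le (R : realFieldType) (a b x y : R) : 0 <= a -> 0 <= b ->
  a + b = 1 -> (a * x + b * y) ^+ 2 <= a * x ^+ 2 + b * y ^+ 2.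
Proof.
move=> a0 b0 ab1; rewrite -subr_ge0.
have -> : a * x ^+ 2 + b * y ^+ 2 - (a * x + b * y) ^+ 2 =
    a * b * (x - y) ^+ 2.
  by have -> : a = 1 - b; [rewrite -ab1 addrK|ring].
by rewrite mulr_ge0 ?sqr_ge0// mulr_ge0.
Qed.

Lemma i01_conv_weights (R : realType) (t : {i01 R}) :
  [/\ 0 <= t%:num, 0 <= 1 - t%:num & t%:num + (1 - t%:num) = 1].
Proof. by split; rewrite ?subr_ge0// addrC subrK. Qed.

Lemma cvg_sum_seq (R : realType) (I : Type) (r : seq I)
    (F : nat -> I -> R) (l : I -> R) :
  (forall i, F n i @[n --> \oo] --> l i) ->
  \sum_(i <- r) F n i @[n --> \oo] --> \sum_(i <- r) l i.
Proof.
move=> Fl; elim: r => [|i r IH].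
  by rewrite big_nil; under eq_fun do rewrite big_nil; exact: cvg_cst.
by rewrite big_cons; under eq_fun do rewrite big_cons; exact: cvgD.
Qed.

Section identification.
Context (R : realType) (tk : time_kind) (k : time R tk -> time R tk -> R).
Context (H : rkhs k) (u : input_time R tk -> R) (A : {fset time R tk}).
Context (y : time R tk -> R) (lambda eps : R) (ws : seq R).
Local Notation V := (rkhs_space H).
Local Notation nrm := (rkhs_norm H).
Local Notation P := (identification_problem H u A y lambda eps ws).
Implicit Types f g : time R tk -> R.
Hypothesis output : forall t, bounded_functional H (system_output u t).
Hypothesis cosf : forall w : R, bounded_functional H (cos_transform w).
Hypothesis sinf : forall w : R, bounded_functional H (sin_transform w).
Hypothesis lambda_gt0 : 0 < lambda.
Hypothesis eps_le1 : eps <= 1.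

(** The regularization makes the objective strongly convex. *)
Lemma objective_conv_le (a b : R) f g : 0 <= a -> 0 <= b -> a + b = 1 ->
  V f -> V g ->
  objective P (a *: f + b *: g) <=
  a * objective P f + b * objective P g - lambda * (a * b) * nrm (f - g) ^+ 2.
Proof.
move=> a0 b0 ab1 Vf Vg; rewrite /= sqr_rkhs_norm_conv//.
set S := \sum_(_ <- _) _; have : S <=
    a * (\sum_(t <- A) (system_output u t f - y t) ^+ 2) +
    b * (\sum_(t <- A) (system_output u t g - y t) ^+ 2).
  rewrite !mulr_sumr -big_split/=; apply: ler_sum => t _.
  rewrite (functional_conv (output t))//.
  apply: le_trans (sqr_conv_le _ _ a0 b0 ab1).
  rewrite le_eqVlt; apply/orP; left; apply/eqP; congr (_ ^+ 2).
  by have -> : a = 1 - b; [rewrite -ab1 addrK|ring].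
move: S (\sum_(_ <- _) _) (\sum_(_ <- _) _) => S S1 S2.
rewrite -subr_ge0 => S_ge0; rewrite -subr_ge0; apply: le_trans S_ge0 _.
by rewrite le_eqVlt; apply/orP; left; apply/eqP; ring.
Qed.

Lemma sqr_cmod_fourier_conv_le (a b w : R) f g :
  0 <= a -> 0 <= b -> a + b = 1 -> V f -> V g ->
  cmod (fourier w (a *: f + b *: g)) ^+ 2 <=
  a * cmod (fourier w f) ^+ 2 + b * cmod (fourier w g) ^+ 2.
Proof.
move=> a0 b0 ab1 Vf Vg; rewrite !sqr_cmod_fourier.
rewrite (functional_conv (cosf w))// (functional_conv (sinf w))//.
by rewrite !mulrDr addrACA lerD// sqr_conv_le.
Qed.

Lemma identification_convex_program : convex_program P.
Proof.
split.
- by move=> f g t /set_mem Vf /set_mem Vg; apply/mem_set; exact: rkhs_conv.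
- move=> t f g /set_mem Vf /set_mem Vg.
  have [t0 t1 t01] := i01_conv_weights t.
  apply: le_trans (objective_conv_le t0 t1 t01 Vf Vg) _.
  have D0 : 0 <= lambda * (t%:num * (1 - t%:num)) * nrm (f - g) ^+ 2.
    by rewrite mulr_ge0 ?sqr_ge0// mulr_ge0 ?mulr_ge0// ltW.
  suff : t%:num * objective P f + (1 - t%:num) * objective P g -
      lambda * (t%:num * (1 - t%:num)) * nrm (f - g) ^+ 2 <=
      t%:num * objective P f + (1 - t%:num) * objective P g by [].
  by rewrite gerBl.
- move=> _ [w _ <-] t f g /set_mem Vf /set_mem Vg.
  have [t0 t1 t01] := i01_conv_weights t.
  have conv := sqr_cmod_fourier_conv_le w t0 t1 t01 Vf Vg.
  apply: le_trans (lerB conv (lexx _)) _.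
  set cf := cmod _ ^+ 2; set cg := cmod _ ^+ 2.
  rewrite le_eqVlt; apply/orP; left; apply/eqP.
  rewrite [RHS](_ : _ =
    t%:num * (cf - (1 - eps)) + (1 - t%:num) * (cg - (1 - eps)))//.
  by ring.
Qed.

Lemma feasibleP f : feasible P f <->
  V f /\ forall w, w \in ws -> cmod (fourier w f) ^+ 2 <= 1 - eps.
Proof.
split=> -[Vf Pf]; split=> //.
  move=> w ws_w; rewrite -subr_le0.
  by apply: (Pf (fun f => cmod (fourier w f) ^+ 2 - (1 - eps))); exists w.
by move=> _ [w ws_w <-]; rewrite subr_le0 Pf.
Qed.

Lemma feasible0 : feasible P 0.
Proof.
apply/feasibleP; split=> [|w _]; first exact: rkhs0.
by rewrite sqr_cmod_fourier (functional0 (cosf w)) (functional0 (sinf w))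
  expr0n addr0 subr_ge0.
Qed.

Lemma objective0 : objective P 0 = data_energy A y.
Proof.
rewrite /= (_ : nrm 0 ^+ 2 = 0) ?mulr0 ?addr0; last first.
  by rewrite sqr_rkhs_norm ?rkhs_ip0l//; exact: rkhs0.
by apply: eq_bigr => t _; rewrite (functional0 (output t)) sub0r sqrrN.
Qed.

Lemma objective_ge g : lambda * nrm g ^+ 2 <= objective P g.
Proof. by rewrite /= lerDr; apply: sumr_ge0 => t _; exact: sqr_ge0. Qed.

Lemma feasible_conv (a b : R) f g : 0 <= a -> 0 <= b -> a + b = 1 ->
  feasible P f -> feasible P g -> feasible P (a *: f + b *: g).
Proof.
move=> a0 b0 ab1 /feasibleP[Vf Pf] /feasibleP[Vg Pg].
apply/feasibleP; split=> [|w ws_w]; first exact: rkhs_conv.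
have := sqr_cmod_fourier_conv_le w a0 b0 ab1 Vf Vg => /le_trans; apply.
have -> : 1 - eps = a * (1 - eps) + b * (1 - eps) by rewrite -mulrDl ab1 mul1r.
by apply: lerD; apply: ler_wpM2l => //; [exact: Pf|exact: Pg].
Qed.

Lemma feasible_closed (f_ : nat -> time R tk -> R) g :
  (forall n, feasible P (f_ n)) -> V g ->
  nrm (f_ n - g) @[n --> \oo] --> (0 : R) -> feasible P g.
Proof.
move=> Pf Vg fg; apply/feasibleP; split=> // w ws_w.
have Vf n : V (f_ n) by have [] := Pf n.
rewrite sqr_cmod_fourier.
have cvg2 l : bounded_functional H l ->
    l (f_ n) ^+ 2 @[n --> \oo] --> l g ^+ 2.
  by move=> bl; have lf := functional_cvg bl Vf Vg fg; exact: cvgM.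
apply: (ler_cvg_to (cvgD (cvg2 _ (cosf w)) (cvg2 _ (sinf w)))
  (cvg_cst (1 - eps))).
apply: nearW => n; have /feasibleP[_ /(_ w ws_w)] := Pf n.
by rewrite sqr_cmod_fourier.
Qed.

Lemma objective_cvg (f_ : nat -> time R tk -> R) g :
  (forall n, V (f_ n)) -> V g ->
  nrm (f_ n - g) @[n --> \oo] --> (0 : R) ->
  objective P (f_ n) @[n --> \oo] --> objective P g.
Proof.
move=> Vf Vg fg /=; apply: cvgD.
  apply: cvg_sum_seq => t; have lt := functional_cvg (output t) Vf Vg fg.
  by apply: cvgM; apply: cvgB => //; exact: cvg_cst.
by apply: cvgZr; exact: sqr_rkhs_norm_cvg.
Qed.

Lemma identification_unique_solution : exists g, unique (is_solution P) g.
Proof.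
apply: (@unique_minimizer _ _ _ H (feasible P) (objective P) (lambda / 4) 0).
- by move=> f [].
- by exists 0; exact: feasible0.
- by move=> f g; apply: feasible_conv; lra.
- exact: feasible_closed.
- move=> f _; apply: le_trans (objective_ge f).
  by rewrite mulr_ge0 ?sqr_ge0// ltW.
- by rewrite divr_gt0.
- move=> f g [Vf _] [Vg _].
  have [h0 h1] : 0 <= 2^-1 :> R /\ 2^-1 + 2^-1 = 1 :> R by split; lra.
  by apply: le_trans (objective_conv_le h0 h0 h1 Vf Vg) _; lra.
- by move=> f_ g Pf; apply: objective_cvg => n; have [] := Pf n.
Qed.

(** The comparison of a solution with the feasible point 0. *)
Lemma sqr_norm_solution_le g : is_solution P g ->
  nrm g ^+ 2 <= lambda^-1 * data_energy A y.
Proof.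
move=> [_ /(_ _ feasible0)]; rewrite objective0 => gy.
by rewrite -ler_pdivrMl ?invr_gt0// invrK (le_trans (objective_ge g)).
Qed.

End identification.

(** * Bound on the transfer function *)

(** For [d = 0] the quotient is infinite and the product [d * x] vanishes. *)
Lemma lee_div_mulr_le (R : realType) (x c d : R) : 0 <= c -> 0 <= d ->
  (x%:E <= c%:E / d%:E)%E -> d * x <= c.
Proof.
move=> c0 d0; have [->|dn0] := eqVneq d 0; first by rewrite mul0r.
rewrite inver (negbTE dn0) -EFinM lee_fin.
by rewrite ler_pdivlMr 1?mulrC// lt_neqAle eq_sym dn0.
Qed.

Lemma cmod_ge0 (R : realType) (z : R[i]) : 0 <= cmod z.
Proof. by case: z => a b; exact: sqrtr_ge0. Qed.

Lemma frequency_le_omega_max_or (R : realType) tk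
    (k : time R tk -> time R tk -> R) (A : {fset time R tk})
    (y : time R tk -> R) (lambda omega_max w : R) :
  is_omega_max k A y lambda omega_max -> @frequencies R tk w ->
  0 <= w <= omega_max \/
  ((cmod (kernel_fourier k w))%:E <= lambda%:E / (data_energy A y)%:E)%E.
Proof.
case: tk k A y => /= k A y; first by move=> ->; rewrite in_itv/=; left.
move=> [_ tail]; rewrite in_itv/= andbT => w0.
have [wmax|/tail] := leP w omega_max; last by right.
by left; rewrite w0.
Qed.

Theorem theorem11 (R : realType) (tk : time_kind)
    (k : time R tk -> time R tk -> R) (H : rkhs k)
    (u : input_time R tk -> R) (A : {fset time R tk}) (y : time R tk -> R)
    (lambda eps omega_max : R) (ws : seq R)
    (P := identification_problem H u A y lambda eps (0 :: ws)) :
  mercer_kernel k ->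
  stable_kernel H ->
  (kernel_moment k 0 < +oo)%E ->
  (kernel_moment k 1 < +oo)%E ->
  (tk = continuous_time ->
    cmod (kernel_fourier k w) @[w --> +oo] --> (0 : R)) ->
  @bounded_input R tk u ->
  0 < lambda ->
  0 < eps < 1 ->
  is_omega_max k A y lambda omega_max ->
  itv_partition 0 omega_max ws ->
  convex_program P /\
  exists g : time R tk -> R,
    [/\ unique (is_solution P) g,
        rkhs_norm H g <= Num.sqrt (lambda^-1 * data_energy A y) &
        ((mesh (0 :: ws))%:E <=
           (2 * eps)%:E / lipschitz_bound k A y lambda)%E ->
        (ereal_sup [set (cmod (fourier w g))%:E | w in @frequencies R tk]
           <= 1)%E].
Proof.
move=> mercer stable mu0_oo mu1_oo _ bu lambda0 /andP[eps0 eps1] om part.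
pose X := model_of_time R tk.
have outf t := output_functional X mercer stable mu0_oo t bu.
have cosf w := cos_functional X mercer stable mu0_oo w.
have sinf w := sin_functional X mercer stable mu0_oo w.
have eps_le1 : eps <= 1 by exact: ltW.
split; first exact: identification_convex_program.
have [g g_uniq] : exists g, unique (is_solution P) g.
  exact: identification_unique_solution.
have g_sol : is_solution P g by case: g_uniq.
have Vg : rkhs_space H g by case: g_sol => -[].
have g_le : rkhs_norm H g ^+ 2 <= lambda^-1 * data_energy A y.
  exact: sqr_norm_solution_le g_sol.
exists g; split=> //.
  by rewrite -[leLHS]ger0_norm ?rkhs_norm_ge0// -sqrtr_sqr ler_wsqrtr.
move=> mesh_le; apply/ereal_supP => _ [w w_freq <-].
rewrite lee_fin -(@expr_le1 _ 2)//; last exact: cmod_ge0.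
have E0 : 0 <= data_energy A y by apply: sumr_ge0 => t _; exact: sqr_ge0.
set m0 := fine (kernel_moment k 0); set m1 := fine (kernel_moment k 1).
have m0_ge0 : 0 <= m0 by apply: fine_ge0; exact: (kernel_moment_ge0 X).
have m1_ge0 : 0 <= m1 by apply: fine_ge0; exact: (kernel_moment_ge0 X).
pose l := lambda^-1 * 4 * m0 * m1 * data_energy A y.
have l0 : 0 <= l by rewrite !mulr_ge0// ?invr_ge0 ltW.
have lE : lipschitz_bound k A y lambda = l%:E.
  rewrite /lipschitz_bound -(fineK_kernel_moment X mu0_oo).
  by rewrite -(fineK_kernel_moment X mu1_oo) -!EFinM.
have {mesh_le} mesh_le : l * mesh (0 :: ws) <= 2 * eps.
  by rewrite lE in mesh_le; apply: lee_div_mulr_le mesh_le => //; lra.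
have low : 0 <= w <= omega_max -> cmod (fourier w g) ^+ 2 <= 1.
  have [_ /eqP <-] := part; move=> /near_partition_point[v ws_v wv].
  have v_le : cmod (fourier v g) ^+ 2 <= 1 - eps.
    by case: g_sol => /feasibleP[_ /(_ v ws_v)].
  have := dist_sqr_cmod_fourier_le X mercer stable mu0_oo mu1_oo w v Vg.
  rewrite -/m0 -/m1 => /(le_trans (ler_norm _)) dist_le.
  have : 4 * m0 * m1 * rkhs_norm H g ^+ 2 * `|w - v| <= eps.
    apply: (@le_trans _ _ (l * (mesh (0 :: ws) / 2))); last lra.
    apply: ler_pM => //; first by rewrite mulr_ge0 ?sqr_ge0// !mulr_ge0.
    have -> : l = 4 * m0 * m1 * (lambda^-1 * data_energy A y).
      by rewrite /l; ring.
    by apply: ler_wpM2l => //; rewrite !mulr_ge0.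
  lra.
have [//|K_le] := frequency_le_omega_max_or om w_freq.
have EK : data_energy A y * cmod (kernel_fourier k w) <= lambda.
  by apply: lee_div_mulr_le K_le => //; exact: ltW.
have FK := sqr_cmod_fourier_le_kernel_fourier X mercer stable mu0_oo w Vg.
apply: le_trans FK _.
apply: (@le_trans _ _
  (lambda^-1 * data_energy A y * cmod (kernel_fourier k w))).
  by rewrite ler_wpM2r// cmod_ge0.
by rewrite -mulrA ler_pdivrMl// mulr1.
Qed.
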